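(* Let $G$ be a (labelled) graph such that the edges $\epsilon_1,\epsilon_2,\dots,\epsilon_k\in E(G)$ form a $k$-cycle, where $k\ge 3$. Then $$\sum_{S\subseteq[k-1]}(-1)^{|S|}\,Y_{G-\cup_{i\in S}\{\epsilon_i\}}=0 .$$ In particular, if $k=3$ and $\epsilon_1,\epsilon_2,\epsilon_3\in E(G)$ form a triangle, then $$Y_G=Y_{G-\epsilon_1}+Y_{G-\epsilon_2}-Y_{G-\{\epsilon_1,\epsilon_2\}} .$$
   Context: All graphs are finite and simple, and labelled: a graph $G$ with $n$ vertices has its vertices labelled bijectively by $[n]=\{1,\dots,n\}$; write $v_i$ for the vertex labelled $i$. $E(G)$ is the edge set. For $T\subseteq E(G)$, $G-T$ denotes $G$ with every edge in $T$ deleted (same labelled vertices), and $G-\epsilon=G-\{\epsilon\}$. Let $x_1,x_2,\dots$ be noncommuting variables. A proper colouring of $G$ is a map $\kappa$ from the vertices to $\{1,2,\dots\}$ with $\kappa(u)\ne\kappa(v)$ whenever $u,v$ are adjacent. The chromatic symmetric function in noncommuting variables is $Y_G=\sum_\kappa x_{\kappa(v_1)}x_{\kappa(v_2)}\cdots x_{\kappa(v_n)}\in\mathbb{Q}\langle\langle x_1,x_2,\dots\rangle\rangle$, summed over all proper colourings $\kappa$ of $G$. *)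

(* Defs.v *)
From HB Require Import structures.
From mathcomp Require Import all_boot all_order all_algebra.
From mathcomp Require Import boolp classical_sets functions fsbigop.

Set Implicit Arguments.
Unset Strict Implicit.
Unset Printing Implicit Defensive.

Import GRing.Theory.
Local Open Scope ring_scope.

(* A simple graph on V is its set of edges, an edge being a 2-element set of
   vertices; [label G i] is v_{i+1}. *)
Record lgraph (V : finType) (n : nat) := LGraph {
  label : 'I_n -> V;
  label_bij : bijective label;
  edges : {set {set V}};
  edges_card2 : forall e, e \in edges -> #|e| = 2%N
}.

Section Graphs.
Variables (V : finType) (n : nat).
Implicit Types (G : lgraph V n) (T : {set {set V}}).

Lemma del_edges_card2 G T e : e \in edges G :\: T -> #|e| = 2%N.
Proof. by case/setDP => eG _; exact: (edges_card2 eG). Qed.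

Definition del_edges G T : lgraph V n :=
  LGraph (label_bij G) (@del_edges_card2 G T).

Definition proper_colouring G (kappa : {ffun V -> nat}) : Prop :=
  forall u v : V, [set u; v] \in edges G -> kappa u != kappa v.

End Graphs.

(* The listed edges are, in some order, the edges c_0c_1, c_1c_2, ..., c_{k-1}c_0
   of a cycle through k >= 3 distinct vertices; [next c] is cyclic successor. *)
Definition form_cycle (V : finType) (es : seq {set V}) : Prop :=
  (3 <= size es)%N /\
  exists2 c : seq V, uniq c & perm_eq es [seq [set x; next c x] | x <- c].

(* Q<<x_1, x_2, ...>> : a noncommutative monomial is a word in the indices of
   the variables, and a series is its family of coefficients. The index c : nat
   stands for x_{c+1}. Only the pointwise linear structure is put on this type:
   the product of series is not the pointwise one. *)
Definition ncseries : Type := seq nat -> rat^o.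
HB.instance Definition _ := GRing.Lmodule.copy ncseries (seq nat -> rat^o).

Definition ncmonomial (w : seq nat) : ncseries := fun w' => (w' == w)%:R.

(* The sum over all proper colourings is taken coefficientwise;
   each coefficient is a finitely supported sum, since a colouring is determined
   by its monomial. *)
Definition Y (V : finType) (n : nat) (G : lgraph V n) : ncseries :=
  fun w => \sum_(kappa \in [set kappa | proper_colouring G kappa]%classic)
             ncmonomial [seq kappa (label G i) | i <- enum 'I_n] w.

(* Main.v *)
Require Import Defs.
From mathcomp Require Import all_boot all_order all_algebra.
From mathcomp Require boolp classical_sets fsbigop.

Set Implicit Arguments.
Unset Strict Implicit.
Unset Printing Implicit Defensive.

Import GRing.Theory.
Local Open Scope ring_scope.

(** The coefficient of [Y_H] at a word [w] of length [n] is 1 or 0 according to whether the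
    single colouring [kappa] spelled out by [w] is proper for [H]. Fix [kappa].
    If one of the edges [eps_1], ..., [eps_(k-1)] is not monochromatic, deleting
    it or not does not affect properness, so adding or removing its index is a
    sign-reversing involution on the sets [S]. Otherwise [kappa] is constant
    along the path these edges form, so [eps_k] is monochromatic; it is never
    deleted, and every term vanishes. *)

Definition monochromatic (V : finType) (kappa : V -> nat) (e : {set V}) : bool :=
  [forall u in e, forall v in e, kappa u == kappa v].

Lemma monochromatic2 (V : finType) (kappa : V -> nat) (u v : V) :
  monochromatic kappa [set u; v] = (kappa u == kappa v).
Proof.
apply/forall_inP/eqP => [mono | kuv x].
  by have /forall_inP/(_ v) := mono u (set21 _ _); rewrite set22 => /(_ isT)/eqP.
by case/set2P=> ->; apply/forall_inP => y /set2P[] ->; rewrite ?kuv.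
Qed.

Lemma proper_colouringP (V : finType) (n : nat) (G : lgraph V n)
    (kappa : {ffun V -> nat}) :
  proper_colouring G kappa <->
  (forall e, e \in edges G -> ~~ monochromatic kappa e).
Proof.
split=> [prop e eG | nmono u v uvG]; last by rewrite -monochromatic2 nmono.
have /cards2P[u [v [_ def_e]]] : #|e| == 2%N by rewrite (edges_card2 eG).
by rewrite def_e monochromatic2 prop // -def_e.
Qed.

(** An edge whose ends get different colours forbids nothing, so only the edges other than [e]
    matter. The hypothesis on edges is symmetric in [G] and [H], hence one implication suffices. *)
Lemma proper_del_edges_eq (V : finType) (n : nat) (G H : lgraph V n)
    (kappa : {ffun V -> nat}) (e : {set V}) :
  ~~ monochromatic kappa e -> edges H :\ e = edges G :\ e ->
  boolp.asbool (proper_colouring H kappa) = boolp.asbool (proper_colouring G kappa).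
Proof.
move=> nmono; wlog suff sub : G H / edges H :\ e = edges G :\ e ->
    proper_colouring G kappa -> proper_colouring H kappa.
  by move=> eqHG; apply: boolp.asbool_equiv_eq; split; apply: sub.
move=> eqHG /proper_colouringP prop; apply/proper_colouringP => f fH.
have [-> // | fe] := eqVneq f e.
by apply: prop; have: f \in edges H :\ e by [rewrite !inE fe]; rewrite eqHG => /setD1P[].
Qed.

(** [kappa] and [b] are chosen before [H]: they depend only on [w] and the labelling, which edge
    deletion preserves, so one colouring governs all terms of the identity. *)
Lemma Y_coefE (V : finType) (n : nat) (G : lgraph V n) (w : seq nat) :
  exists (kappa : {ffun V -> nat}) (b : bool), forall H : lgraph V n,
    label H = label G ->
    Y H w = (b && boolp.asbool (proper_colouring H kappa))%:R.
Proof.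
have [g labelK gK] := label_bij G.
(* The default 0 is read only if [w] is shorter than [n], and then the coefficient is 0 anyway. *)
pose kappa := [ffun v => nth 0%N w (g v)].
have wordE (f : {ffun V -> nat}) :
    (w == [seq f (label G i) | i <- enum 'I_n]) = (size w == n) && (f == kappa).
  apply/eqP/andP => [def_w | [/eqP sz_w /eqP->]].
    rewrite def_w size_map size_enum_ord; split=> //; apply/eqP/ffunP => v.
    by rewrite ffunE def_w -{1}[v]gK (nth_map (g v)) ?size_enum_ord // nth_ord_enum.
  apply: (@eq_from_nth _ 0%N) => [|i]; first by rewrite size_map size_enum_ord.
  rewrite sz_w => lt_i_n; rewrite (nth_map (Ordinal lt_i_n)) ?size_enum_ord //.
  by rewrite ffunE labelK nth_enum_ord.
exists kappa, (size w == n) => H eq_label; rewrite /Y /ncmonomial eq_label.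
(* By [wordE], [kappa] is the only colouring whose monomial can be [w], so at most one term
   survives. *)
have [prop|nprop] := boolp.asboolP (proper_colouring H kappa); last first.
  rewrite andbF fsbigop.fsbig1 // => f /= propf; rewrite wordE.
  by case: (f =P kappa) propf => [-> /nprop // |]; rewrite andbF.
rewrite andbT -(fsbigop.fsbig_widen (classical_sets.set1 kappa)).
- by rewrite fsbigop.fsbig_set1 wordE eqxx andbT.
- by move=> f /= ->.
- by move=> f [_ /= /eqP/negPf nf]; rewrite wordE nf andbF.
Qed.

(** Two distinct vertices with the same edge would be successors of each other, closing the cycle
    after two steps. *)
Lemma next_edge_inj (V : finType) (c : seq V) :
  uniq c -> (3 <= size c)%N ->
  {in c &, injective (fun x => [set x; next c x])}.
Proof.
move=> uniq_c size_c x y xc yc /= eq_xy; apply/eqP/idPn => neq_xy.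
have y_next : y = next c x.
  by have := set21 y (next c y); rewrite -eq_xy => /set2P[] // /esym/eqP/idPn.
have x_next : x = next c y.
  by have := set21 x (next c x); rewrite eq_xy => /set2P[] // /eqP/idPn.
(* Rotated to start at [x], the cycle begins [x], [a], [b]; then [a = y] and [b = x], a
   repetition. *)
have [i p rot_c] := rot_to xc.
move: size_c uniq_c (next_rot i uniq_c x) (next_rot i uniq_c y).
rewrite -(size_rot i) -(rot_uniq i) rot_c -x_next -y_next.
case: p {rot_c} => [|a [|b p]] //= _ uniq_p; rewrite eqxx => def_a.
rewrite def_a eqxx [y == x]eq_sym (negPf neq_xy) => def_b.
by rewrite def_b !inE eqxx !orbT in uniq_p.
Qed.

Lemma form_cycle_uniq (V : finType) (es : seq {set V}) :
  form_cycle es -> uniq es.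
Proof.
case=> size_es [c uniq_c perm_es]; rewrite (perm_uniq perm_es) map_inj_in_uniq //.
by apply: next_edge_inj => //; rewrite (perm_size perm_es) size_map in size_es.
Qed.

Lemma path_frel_constant (T : eqType) (R : Type) (f : T -> R) (h : T -> T)
    (x y : T) (s : seq T) :
  path (frel h) y (rcons s x) -> {in y :: s, forall a, f (h a) = f a} -> f x = f y.
Proof.
elim: s y => [|z s IHs] y /=; first by rewrite andbT => /eqP<- ->; rewrite ?mem_head.
case/andP=> /eqP hy path_s fh; rewrite (IHs z) // => [|a as_].
  by rewrite -hy fh ?mem_head.
by rewrite fh // inE as_ orbT.
Qed.

(** Removing [e] opens the cycle into a path joining the ends of [e]; the colour is constant along
    it. *)
Lemma form_cycle_monochromatic (V : finType) (kappa : V -> nat)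
    (es : seq {set V}) (e : {set V}) :
  form_cycle es -> e \in es ->
  (forall f, f \in es -> f != e -> monochromatic kappa f) ->
  monochromatic kappa e.
Proof.
case=> size_es [c uniq_c perm_es].
have inj_c : {in c &, injective (fun x => [set x; next c x])}.
  by apply: next_edge_inj => //; rewrite (perm_size perm_es) size_map in size_es.
rewrite (perm_mem perm_es) => /mapP[x xc ->] mono.
have [i p rot_c] := rot_to xc.
have mono_p a : a \in p -> kappa (next c a) = kappa a.
  have : uniq (x :: p) by rewrite -rot_c rot_uniq.
  move=> /= /andP[xp _] ap; apply/eqP; rewrite eq_sym -monochromatic2.
  have ac : a \in c by rewrite -(mem_rot i) rot_c inE ap orbT.
  apply: mono; first by rewrite (perm_mem perm_es) (map_f (fun x => _)).
  (* If [a] gave the same edge as [x], then [a] would be [x], which is not in [p]. *)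
  by apply: contraNneq xp => /inj_c <-.
have : fcycle (next c) (x :: p) by rewrite -rot_c rot_cycle cycle_next.
rewrite monochromatic2; case: p {rot_c} mono_p => [|y q] mono_p /=.
  by rewrite andbT => /eqP->.
by case/andP=> /eqP-> /path_frel_constant-> //.
Qed.

(** For [j] outside [S], the sets [S] and [j |: S] carry opposite signs and equal values of [F], so
    they cancel; [j \in A] keeps both in the range. *)
Lemma sum_toggle_eq0 (R : numDomainType) (I : finType) (A : {set I}) (j : I)
    (F : {set I} -> R) :
  j \in A -> (forall S, F (j |: S) = F (S :\ j)) ->
  \sum_(S : {set I} | S \subset A) (-1) ^+ #|S| * F S = 0.
Proof.
move=> jA toggleF; rewrite (bigID (fun S : {set I} => j \in S)) /=.
rewrite (reindex_onto (fun S => j |: S) (fun S => S :\ j)) /=; last first.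
  by move=> S /andP[_ jS]; rewrite setD1K.
rewrite (eq_bigl (fun S : {set I} => (S \subset A) && (j \notin S))) => [|S].
  rewrite -big_split big1 // => S /andP[_ jS] /=.
  have SjK : S :\ j = S by apply/setDidPl; rewrite disjoint_sym disjoints1.
  by rewrite toggleF SjK cardsU1 jS exprS mulN1r mulNr addNr.
rewrite subUset sub1set jA setU11 /= andbT; congr (_ && _).
by apply/eqP/idP => [<- | /setU1K //]; rewrite !inE eqxx.
Qed.

Theorem proposition3p6 (V : finType) (n : nat) (G : lgraph V n) :
  (forall (k : nat) (eps : k.-tuple {set V}),
      (3 <= k)%N ->
      {subset eps <= edges G} ->
      form_cycle eps ->
      \sum_(S : {set 'I_k} | S \subset [set i : 'I_k | (i < k.-1)%N])
        (-1) ^+ #|S|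
          *: Y (del_edges G (\bigcup_(i in S) [set tnth eps i])) = 0)
  /\
  (forall e1 e2 e3 : {set V},
      e1 \in edges G -> e2 \in edges G -> e3 \in edges G ->
      form_cycle [:: e1; e2; e3] ->
      Y G = Y (del_edges G [set e1]) + Y (del_edges G [set e2])
            - Y (del_edges G [set e1; e2])).
Proof.
split=> [k eps k_ge3 eps_G cyc_eps | e1 e2 e3 e1G e2G e3G cyc_e].
  apply: boolp.funext => w; have [kappa [b coefY]] := Y_coefE G w.
  pose prop (S : {set 'I_k}) : bool := boolp.asbool
    (proper_colouring (del_edges G (\bigcup_(i in S) [set tnth eps i])) kappa).
  set A := [set i : 'I_k | _].
  transitivity (\sum_(S : {set 'I_k} | S \subset A)
      (-1) ^+ #|S| * (b && prop S)%:R : rat).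
    rewrite (big_morph (fun f : ncseries => f w) (id1 := 0) (op1 := +%R)) //.
    by apply: eq_bigr => S _; rewrite -coefY.
  have [/exists_inP[j jA nmono] | /exists_inPn mono] :=
      boolP [exists j in A, ~~ monochromatic kappa (tnth eps j)].
    apply: (sum_toggle_eq0 jA) => S; congr ((b && _)%:R).
    (* Toggling [j] changes the remaining edges at most at [tnth eps j]. *)
    apply: (proper_del_edges_eq nmono); apply/setP => e; rewrite !inE.
    case: eqVneq => //= ne; congr (~~ _ && _).
    apply/bigcupP/bigcupP => -[i iS]; rewrite inE => /eqP def_e;
      exists i; rewrite ?inE ?def_e //; move: iS; rewrite !inE.
      by case: eqP => // ij; rewrite def_e ij eqxx in ne.
    by case/andP=> _ ->; rewrite orbT.
  rewrite big1 // => S SA; suff /negPf-> : ~~ prop S by rewrite andbF mulr0.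
  have k_gt0 : (0 < k)%N by apply: leq_trans k_ge3.
  have last_lt : (k.-1 < k)%N by rewrite prednK.
  (* Indices start at 0, so [l] is the index of the last edge of the cycle, the one outside [A]. As
     the edges are distinct, it cannot be deleted under another index either. *)
  pose l := Ordinal last_lt.
  have inj_eps : injective (tnth eps) by apply/tuple_uniqP/form_cycle_uniq.
  apply/negP => /boolp.asboolP/proper_colouringP/(_ (tnth eps l)) nmono_l.
  suff mono_l : monochromatic kappa (tnth eps l).
    rewrite mono_l in nmono_l; apply/notF/nmono_l.
    rewrite inE eps_G ?mem_tnth // andbT.
    apply/bigcupP => -[i iS]; rewrite inE => /eqP/inj_eps def_i.
    by have := subsetP SA i iS; rewrite -def_i inE ltnn.
  apply: (form_cycle_monochromatic cyc_eps); first exact: mem_tnth.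
  move=> _ /tnthP[i ->]; rewrite (inj_eq inj_eps) => neq_il.
  apply/negPn/mono; rewrite inE ltn_neqAle -ltnS prednK // ltn_ord andbT.
  exact: neq_il.
have := form_cycle_uniq cyc_e; rewrite /= !inE negb_or andbT.
case/andP=> /andP[ne12 ne13] ne23.
apply: boolp.funext => w; have [kappa [b coefY]] := Y_coefE G w.
(* Series are added coefficientwise, so this is a conversion that exposes the coefficients at
   [w]. *)
transitivity ((Y (del_edges G [set e1]) w : rat) + (Y (del_edges G [set e2]) w : rat)
              - (Y (del_edges G [set e1; e2]) w : rat)); last by [].
rewrite !coefY //.
(* If [e1] is not monochromatic, the coefficients of [G] and [G - e1] agree, and so do those of
   [G - e2] and [G - {e1, e2}]. *)
have [mono1 | nmono1] := boolP (monochromatic kappa e1); last first.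
  rewrite (@proper_del_edges_eq _ _ G (del_edges G [set e1]) _ _ nmono1).
    rewrite (@proper_del_edges_eq _ _ (del_edges G [set e2])
               (del_edges G [set e1; e2]) _ _ nmono1) ?addrK //.
    by apply/setP => e; rewrite !inE; case: eqVneq.
  by apply/setP => e; rewrite !inE; case: eqVneq.
have [mono2 | nmono2] := boolP (monochromatic kappa e2); last first.
  rewrite (@proper_del_edges_eq _ _ G (del_edges G [set e2]) _ _ nmono2).
    rewrite (@proper_del_edges_eq _ _ (del_edges G [set e1])
               (del_edges G [set e1; e2]) _ _ nmono2) 1?addrC ?addKr //.
    by apply/setP => e; rewrite !inE orbC; case: eqVneq.
  by apply/setP => e; rewrite !inE; case: eqVneq.
have mono3 : monochromatic kappa e3.
  apply: (form_cycle_monochromatic cyc_e); first by rewrite !inE eqxx !orbT.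
  by move=> e; rewrite !inE => /or3P[] /eqP-> //; rewrite eqxx.
(* [e3] survives in all four graphs, so all four coefficients are 0. *)
have nprop H : e3 \in edges H -> boolp.asbool (proper_colouring H kappa) = false.
  move=> e3H; apply: boolp.asboolF => /proper_colouringP/(_ _ e3H).
  by rewrite mono3.
by rewrite !nprop ?inE ?e3G ?[e3 == _]eq_sym
           ?(negPf ne13) ?(negPf ne23) ?andbF ?addr0 ?subr0.
Qed.
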